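(* Let $X$ be a totally ordered set with $|X|\geq 2$ and let $\mathcal{B} \subset \mathrm{Br}(X)$ be the Hall set of the Lyndon basis. 1. If $|X|\geq 3$, then for every $a<b \in \mathcal{B}$, $\|[a,b]\|_{\mathcal{B}} \leq 2^{|b|-1}$. 2. If $X \supset \{ X_0, X_1, X_2 \}$ with $X_0 < X_1 < X_2$, then for every $n\in \mathbb{N}$, $\mathrm{ad}_{X_1}^n (X_2) \in \mathcal{B}$ and $\| [X_0, \mathrm{ad}_{X_1}^n(X_2)] \|_{\mathcal{B}} = 2^n$ (so the estimate of item 1 is optimal). 3. If $|X|=2$, then for every $a<b \in \mathcal{B}$ with $|b|\geq 2$, $\|[a,b]\|_{\mathcal{B}} \leq 2^{|b|-2}$. 4. If $X=\{X_0,X_1\}$ with $X_0<X_1$, then for every $n \in \mathbb{N}^*$, $\mathrm{ad}_{X_0}^2(X_1)$ and $\underline{\mathrm{ad}}_{X_1}^n(X_0)$ belong to $\mathcal{B}$, $\mathrm{ad}_{X_0}^2(X_1) < \underline{\mathrm{ad}}_{X_1}^n(X_0)$, and $\|[\mathrm{ad}_{X_0}^2(X_1), \underline{\mathrm{ad}}_{X_1}^n(X_0)]\|_{\mathcal{B}}=2^{n-1}$ (so the estimate of item 3 is optimal).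
   Context: The base field is $\mathbb{K}=\mathbb{R}$ or $\mathbb{C}$; $X$ is a set (possibly infinite) with at least two elements; $\mathbb{N}=\{0,1,\dots\}$, $\mathbb{N}^*=\{1,2,\dots\}$. $\mathrm{Br}(X)$ is the free magma over $X$: the set of formal binary brackets (rooted planar binary trees with leaves labelled by elements of $X$), with product $(t_1,t_2)$. For $t\in \mathrm{Br}(X)$, $|t|$ is its number of leaves; if $t\notin X$, $t$ is written uniquely as $t=(\lambda(t),\mu(t))$. For $t_1,t_2\in\mathrm{Br}(X)$, $\mathrm{ad}_{t_1}(t_2):=(t_1,t_2)$ and $\underline{\mathrm{ad}}_{t_1}(t_2):=(t_2,t_1)$. $\mathcal{L}(X)$ is the free Lie algebra over $X$ and $\mathrm{ev}:\mathrm{Br}(X)\to\mathcal{L}(X)$ is the canonical evaluation ($\mathrm{ev}(x)=x$ for $x\in X$, $\mathrm{ev}((t_1,t_2))=[\mathrm{ev}(t_1),\mathrm{ev}(t_2)]$). For $a,b\in\mathrm{Br}(X)$, $[a,b]$ denotes $[\mathrm{ev}(a),\mathrm{ev}(b)]\in\mathcal{L}(X)$. A Hall set is a subset $\mathcal{B}\subset\mathrm{Br}(X)$ endowed with a total order $<$ such that: (i) $X\subset\mathcal{B}$; (ii) for all $b_1,b_2\in\mathrm{Br}(X)$, $(b_1,b_2)\in\mathcal{B}$ iff $b_1,b_2\in\mathcal{B}$, $b_1<b_2$ and either $b_2\in X$ or $\lambda(b_2)\leq b_1$; (iii) for all $b_1,b_2\in\mathcal{B}$ with $(b_1,b_2)\in\mathcal{B}$,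 $b_1<(b_1,b_2)$. By a theorem of Viennot, $\mathrm{ev}$ is injective on $\mathcal{B}$ and $\mathrm{ev}(\mathcal{B})$ is a basis of $\mathcal{L}(X)$. For $u=\sum_{c\in\mathcal{B}}\alpha_c\,\mathrm{ev}(c)\in\mathcal{L}(X)$ (finite sum), $\|u\|_{\mathcal{B}}:=\sum_{c}|\alpha_c|$. Lyndon basis: $X$ is totally ordered and the free monoid $X^*$ carries the induced lexicographic order. A word $w\in X^*$ is a Lyndon word if $w\in X$, or if $w<vu$ for every factorization $w=uv$ into nonempty words. The standard factorization of a Lyndon word $w\notin X$ is the factorization $w=uv$ with $u,v$ Lyndon words and $u$ of maximal length. Define $\mathrm{br}$ from Lyndon words to $\mathrm{Br}(X)$ by $\mathrm{br}(x)=x$ for $x\in X$ and $\mathrm{br}(w)=(\mathrm{br}(u),\mathrm{br}(v))$ for $w=uv$ the standard factorization. The set $\mathcal{B}$ of all $\mathrm{br}(w)$, $w$ Lyndon, ordered by the lexicographic order on the foliage (the word read on the leaves), is a Hall set (known fact), called the Hall set of the Lyndon basis. *)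

(* Defs.v *)
From HB Require Import structures.
From mathcomp Require Import all_boot all_order all_algebra finmap.
From mathcomp Require Import complex.
From mathcomp Require Import boolp classical_sets functions cardinality reals.

Set Implicit Arguments.
Unset Strict Implicit.
Unset Printing Implicit Defensive.

Import Order.TTheory GRing.Theory Num.Theory.
Local Open Scope classical_set_scope.
Local Open Scope ring_scope.

Inductive Br (X : Type) : Type :=
| Leaf of X
| Node of Br X & Br X.

Fixpoint tree_of_Br (X : Type) (t : Br X) : GenTree.tree X :=
  match t with
  | Leaf x => GenTree.Leaf x
  | Node t1 t2 => GenTree.Node 0 [:: tree_of_Br t1; tree_of_Br t2]
  end.

Fixpoint Br_of_tree (X : Type) (t : GenTree.tree X) : option (Br X) :=
  match t with
  | GenTree.Leaf x => Some (Leaf x)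
  | GenTree.Node _ [:: t1; t2] =>
      if (Br_of_tree t1, Br_of_tree t2) is (Some b1, Some b2)
      then Some (Node b1 b2) else None
  | _ => None
  end.

Lemma tree_of_BrK (X : Type) : pcancel (@tree_of_Br X) (@Br_of_tree X).
Proof. by elim=> //= t1 -> t2 ->. Qed.

HB.instance Definition _ (X : eqType) :=
  Equality.copy (Br X) (pcan_type (@tree_of_BrK X)).
HB.instance Definition _ (X : choiceType) :=
  Choice.copy (Br X) (pcan_type (@tree_of_BrK X)).

Fixpoint foliage (X : Type) (t : Br X) : seq X :=
  match t with
  | Leaf x => [:: x]
  | Node t1 t2 => foliage t1 ++ foliage t2
  end.

Definition leaves (X : Type) (t : Br X) : nat := size (foliage t).

Definition ad (X : Type) (t1 t2 : Br X) : Br X := Node t1 t2.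
Definition ad_under (X : Type) (t1 t2 : Br X) : Br X := Node t2 t1.

HB.mixin Record Lmodule_isLieAlgebra (K : pzRingType) L of GRing.Lmodule K L := {
  lie : L -> L -> L;
  lie_linearl : forall v : L, linear (fun u => lie u v);
  lie_linearr : forall u : L, linear (lie u);
  lie_alt : forall u : L, lie u u = 0;
  lie_jacobi : forall u v w : L,
    lie u (lie v w) + lie v (lie w u) + lie w (lie u v) = 0
}.

#[short(type="lieAlgType")]
HB.structure Definition LieAlgebra (K : pzRingType) :=
  { L of GRing.Lmodule K L & Lmodule_isLieAlgebra K L }.

Definition lie_morphism (K : pzRingType) (L M : lieAlgType K) (f : L -> M) :
    Prop :=
  linear f /\ {morph f : u v / lie u v}.

(* The free Lie algebra over X is characterised by its universal property,
   i.e. up to unique isomorphism; iota is the inclusion of the generators. *)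
Definition free_lie (K : pzRingType) (X : Type) (L : lieAlgType K)
    (iota : X -> L) : Prop :=
  forall (M : lieAlgType K) (f : X -> M), exists g : L -> M,
    [/\ lie_morphism g, forall x, g (iota x) = f x &
        forall h : L -> M,
          lie_morphism h -> (forall x, h (iota x) = f x) -> h =1 g].

Fixpoint ev (K : pzRingType) (X : Type) (L : lieAlgType K) (iota : X -> L)
    (t : Br X) : L :=
  match t with
  | Leaf x => iota x
  | Node t1 t2 => lie (ev iota t1) (ev iota t2)
  end.

Definition decomposition (K : numFieldType) (X : choiceType)
    (L : lieAlgType K) (iota : X -> L) (B : set (Br X)) (u : L) :
    set {fsfun Br X -> K with 0} :=
  [set alpha | [set` finsupp alpha] `<=` B /\
               u = \sum_(c <- finsupp alpha) alpha c *: ev iota c].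

(* When ev maps B injectively to a basis of L (as it does for Hall sets, by
   Viennot's theorem), u has exactly one decomposition; otherwise the value is
   that of an arbitrary decomposition, or of the zero family if none exists. *)
Definition coef (K : numFieldType) (X : choiceType)
    (L : lieAlgType K) (iota : X -> L) (B : set (Br X)) (u : L) :
    {fsfun Br X -> K with 0} :=
  xget [fsfun] (decomposition iota B u).

Definition hall_norm (K : numFieldType) (X : choiceType)
    (L : lieAlgType K) (iota : X -> L) (B : set (Br X)) (u : L) : K :=
  \sum_(c <- finsupp (coef iota B u)) `|coef iota B u c|.

(* Lexicographic order on words; a proper prefix is smaller. *)
Definition lexlt (d : Order.disp_t) (X : orderType d) (u v : seq X) : bool :=
  ((u : seqlexi X) < (v : seqlexi X))%O.

Definition lyndon (d : Order.disp_t) (X : orderType d) (w : seq X) : Prop :=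
  w <> [::] /\
  forall u v : seq X, u <> [::] -> v <> [::] -> w = u ++ v -> lexlt w (v ++ u).

Definition standard_factorization (d : Order.disp_t) (X : orderType d)
    (w u v : seq X) : Prop :=
  [/\ w = u ++ v, lyndon w, lyndon u, lyndon v &
      forall u' v' : seq X, w = u' ++ v' -> lyndon u' -> lyndon v' ->
        (size u' <= size u)%N].

(* Graph of the map br from Lyndon words to brackets: is_br w t reads
   "w is Lyndon and br w = t". *)
Inductive is_br (d : Order.disp_t) (X : orderType d) : seq X -> Br X -> Prop :=
| is_br_leaf (x : X) : is_br [:: x] (Leaf x)
| is_br_node (w u v : seq X) (t1 t2 : Br X) :
    standard_factorization w u v -> is_br u t1 -> is_br v t2 ->
    is_br w (Node t1 t2).

Definition lyndon_basis (d : Order.disp_t) (X : orderType d) : set (Br X) :=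
  [set t | exists w : seq X, lyndon w /\ is_br w t].

Definition hall_lt (d : Order.disp_t) (X : orderType d) (a b : Br X) : bool :=
  lexlt (foliage a) (foliage b).

(* Main.v *)
(* The key is that, for a < b, the support of [a, b] stays under control.  If b = (b', b'')
   and a < b' (otherwise (a, b) is itself a Lyndon bracket), then
   [a, b] = [[a, b'], b''] + [b', [a, b'']].  By induction on b, every c in the support of
   [a, b'] satisfies c < b' < b'', so [c, b''] is covered by the induction hypothesis for
   b''; every c in the support of [a, b''] either satisfies c < b', and [b', c] = - [c, b']
   is covered by the hypothesis for b', or is such that (b', c) is already a Lyndon bracket.
   Hence any weight W >= 1 on brackets with 2 W(b') W(b'') <= W(b) whenever some a < b'
   exists bounds the norm of [a, b].  W(b) = 2^(|b|-1) always works, and W(b) = 2^(|b|-2)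
   works over two letters because there b' cannot be a letter.
   Coordinates in the Lyndon basis are unique because, in noncommutative power series, the
   bracket of a Lyndon word w is w plus lexicographically larger words.
   For optimality, expanding [a, ad_y^n z] by the Jacobi identity produces n + 1 distinct
   Lyndon brackets with signed binomial coefficients. *)

From HB Require Import structures.
Require Import Defs.
From mathcomp Require Import all_boot all_order all_algebra finmap.
From mathcomp Require Import complex.
From mathcomp Require Import boolp classical_sets functions cardinality reals.
From mathcomp Require Import ring zify.

Set Implicit Arguments.
Unset Strict Implicit.
Unset Printing Implicit Defensive.

Import Order.TTheory GRing.Theory Num.Theory.
Local Open Scope card_scope.
Local Open Scope classical_set_scope.
Local Open Scope ring_scope.

(** * Lyndon words *)

Section Words.
Context (d : Order.disp_t) (X : orderType d).
Implicit Types (x y : X) (u v w p s : seq X).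

Local Notation "u <l v" := (lexlt u v) (at level 70).
Local Notation "u <=l v" := ((u : seqlexi X) <= (v : seqlexi X))%O (at level 70).

Lemma lexlt_cons x u y v :
  x :: u <l y :: v = (x < y)%O || (x == y) && (u <l v).
Proof.
by rewrite /lexlt Order.SeqLexiOrder.ltxi_cons; case: (ltgtP x y).
Qed.

Lemma lexlt0l v : [::] <l v = (v != [::]).
Proof. exact: Order.SeqLexiOrder.ltxi0s. Qed.

Lemma lexltl0 u : u <l [::] = false.
Proof. exact: Order.SeqLexiOrder.ltxis0. Qed.

Lemma lexlt_catl p u v : (p ++ u <l p ++ v) = (u <l v).
Proof. by elim: p => //= x p IH; rewrite lexlt_cons ltxx eqxx IH. Qed.

(* [u] and [v] differ at some position, and [u] is smaller at the first one. *)
Fixpoint slt u v : bool :=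
  match u, v with
  | x :: u', y :: v' => (x < y)%O || (x == y) && slt u' v'
  | _, _ => false
  end.

Lemma slt_catl p u v : slt (p ++ u) (p ++ v) = slt u v.
Proof. by elim: p => //= x p IH; rewrite ltxx eqxx IH. Qed.

Lemma slt_catr u v s t : slt u v -> slt (u ++ s) (v ++ t).
Proof.
elim: u v => [|x u IH] [|y v] //= /orP[->//|/andP[-> /IH ->]].
by rewrite orbT.
Qed.

Lemma lexltE u v : u <l v = slt u v || prefix u v && (u != v).
Proof.
elim: u v => [|x u IH] [|y v]; rewrite ?lexltl0 // ?lexlt0l ?prefix0s //.
by rewrite lexlt_cons prefix_cons eqseq_cons IH /=; case: ltgtP.
Qed.

Lemma slt_lexlt u v : slt u v -> u <l v.
Proof. by rewrite lexltE => ->. Qed.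

Lemma slt_trans : transitive slt.
Proof.
elim=> [|y v IH] [|x u] [|z w] //= /orP[xy|/andP[/eqP-> uv]].
  by case/orP=> [yz|/andP[/eqP<- _]]; rewrite ?xy // (lt_trans xy yz).
by case/orP=> [->//|/andP[-> /(IH _ _ uv) ->]]; rewrite orbT.
Qed.

Lemma prefix_sltF u v : prefix u v -> slt u v = false.
Proof.
by elim: u v => [|x u IH] [|y v] //=; case: ltgtP => //= _ /IH.
Qed.

Lemma prefix_sltFr u v : prefix u v -> slt v u = false.
Proof.
by elim: u v => [|x u IH] [|y v] //=; case: ltgtP => //= _ /IH.
Qed.

Lemma sltW_size u v : u <l v -> (size v <= size u)%N -> slt u v.
Proof.
rewrite lexltE => /orP[//|/andP[/prefixP[s ->]]].
rewrite size_cat -[leqRHS]addn0 leq_add2l leqn0 size_eq0 => uv /eqP s0.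
by rewrite s0 cats0 eqxx in uv.
Qed.

Lemma slt_le_trans u v w : slt u v -> v <=l w -> slt u w.
Proof.
rewrite le_eqVlt => uv /predU1P[<-//|].
rewrite -[(_ < _)%O]/(v <l w) lexltE => /orP[|/andP[/prefixP[s ->] _]].
  exact: slt_trans.
by rewrite -[u]cats0; apply: slt_catr.
Qed.

Lemma lt_le_lexlt u v w : u <l v -> v <=l w -> u <l w.
Proof. exact: lt_le_trans. Qed.

Lemma lexlt_total u v : [\/ u <l v, u = v | v <l u].
Proof.
rewrite /lexlt; case: (ltgtP (u : seqlexi X) v) => [?|?|->];
  by [constructor 1|constructor 3|constructor 2].
Qed.

Lemma lexlt_asym u v : u <l v -> v <l u = false.
Proof. exact: lt_gtF. Qed.

Lemma lexltNge u v : (u <l v) = ~~ (v <=l u).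
Proof. by rewrite /lexlt ltNge. Qed.

Lemma lexltxx u : u <l u = false.
Proof. exact: ltxx. Qed.

Lemma lexlt_trans u v w : u <l v -> v <l w -> u <l w.
Proof. exact: lt_trans. Qed.

Lemma prefix_lexle u v : prefix u v -> u <=l v.
Proof.
move=> uv; rewrite le_eqVlt -[(_ < _)%O]/(u <l v) lexltE uv /=.
by case: eqVneq; rewrite ?orbT.
Qed.

Lemma lexle_cat u1 u2 v1 v2 : size u1 = size v1 ->
  u1 <=l v1 -> u2 <=l v2 -> (u1 ++ u2) <=l (v1 ++ v2).
Proof.
move=> sz; rewrite le_eqVlt => /predU1P[<- |u1v1 _].
  by rewrite !leNgt -!/(lexlt _ _) lexlt_catl.
by apply/ltW/slt_lexlt/slt_catr/sltW_size; rewrite // sz.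
Qed.

(** * Characterisation and factorisation of Lyndon words *)

Definition lyndon_suffix w :=
  w <> [::] /\ forall u v, u <> [::] -> v <> [::] -> w = u ++ v -> w <l v.

(** A suffix [v < w] that differs from [w] at some position would give a rotation below [w], so only
    a suffix that is also a prefix has to be excluded. *)
Lemma lyndonP w : lyndon w <-> lyndon_suffix w.
Proof.
split=> -[w0 lw]; split=> // u v u0 v0 wE; last first.
  have wv := lw u v u0 v0 wE.
  have : slt w v by apply: sltW_size wv _; rewrite wE size_cat leq_addl.
  by move=> /(slt_catr [::] u); rewrite cats0 => /slt_lexlt.
have [//|wv|vw] := lexlt_total w v.
  case: u u0 wE => // x u _; rewrite -wv => /(congr1 size)/eqP.
  by rewrite size_cat -[X in X == _]add0n eqn_add2r.
move: (vw); rewrite lexltE => /orP[vw'|/andP[/prefixP[z wz] _]].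
  have := lw u v u0 v0 wE; rewrite lexltNge ltW // -/(lexlt _ _).
  by apply: slt_lexlt; rewrite -[w]cats0; apply: slt_catr.
(* Here [w = u v = v z] with [u] and [z] of equal length: the rotation [v u] forces [z < u], and
   then the rotation [z v] lies below [u v = w]. *)
have sz : size z = size u.
  by move/(congr1 size): wE; rewrite wz !size_cat addnC => /addIn.
have := lw u v u0 v0 wE; rewrite {1}wz lexlt_catl => zu.
have z0 : z <> [::] by move=> z0; case: u u0 sz {wE zu}; rewrite ?z0.
have := lw v z v0 z0 wz; rewrite lexlt_asym // wE.
by apply/slt_lexlt/slt_catr/sltW_size; rewrite // sz.
Qed.

Lemma lyndon_neq0 w : lyndon w -> w <> [::]. Proof. by case. Qed.

Lemma lyndon_lt_suffix u v : lyndon (u ++ v) -> u <> [::] -> v <> [::] ->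
  slt (u ++ v) v.
Proof.
move=> /lyndonP[_ l] u0 v0; apply: sltW_size (l u v u0 v0 erefl) _.
by rewrite size_cat leq_addl.
Qed.

Lemma lyndon1 x : lyndon [:: x].
Proof. by split=> // -[|y u] [|z v] // _ _ [_]; case: u. Qed.

(** If [v = u s], cancelling [u] leaves the comparison of [v] with its proper suffix [s]. *)
Lemma lyndon_slt_cat u v : lyndon u -> lyndon v -> u <l v -> slt (u ++ v) v.
Proof.
move=> lu lv; rewrite lexltE => /orP[uv|/andP[/prefixP[s vE] uv]].
  by rewrite -[X in slt _ X]cats0; apply: slt_catr.
rewrite vE slt_catl -vE; subst v; apply: lyndon_lt_suffix => //.
  exact: lyndon_neq0.
by move=> s0; rewrite s0 cats0 eqxx in uv.
Qed.

(** A proper suffix begins inside [u], where [u] being Lyndon decides, or is a suffix of [v], hence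
    at least [v], which exceeds [u v]. *)
Lemma lyndon_cat u v : lyndon u -> lyndon v -> u <l v -> lyndon (u ++ v).
Proof.
move=> lu lv uv; have uvv := lyndon_slt_cat lu lv uv.
apply/lyndonP; split=> [|s t s0 t0 E].
  by case: u lu {uv uvv} => // -[].
case: (leqP (size s) (size u)) => sz.
  have /eqP Eu : take (size s) (u ++ v) == s by rewrite E take_size_cat.
  have ut := drop_size_cat t (erefl (size s)); rewrite -E in ut.
  rewrite drop_cat in ut; case: ltnP ut => [lt_su tE|le_us tE]; last first.
    by apply: slt_lexlt; rewrite -tE (@anti_leq (size s) (size u)) ?sz //
      ?subnn ?drop0 // sz.
  rewrite -tE; apply/slt_lexlt/slt_catr.
  rewrite -{1}(cat_take_drop (size s) u); apply: lyndon_lt_suffix.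
  - by rewrite cat_take_drop.
  - by move/(congr1 size); rewrite size_takel // => /size0nil.
  - by move/(congr1 size)/eqP; rewrite size_drop subn_eq0 leqNgt lt_su.
have ut := drop_size_cat t (erefl (size s)); rewrite -E in ut.
rewrite drop_cat ltnNge (ltnW sz) /= in ut.
apply: slt_lexlt; apply: slt_le_trans uvv _; rewrite -ut.
rewrite -{1}(cat_take_drop (size s - size u) v); apply/ltW/slt_lexlt.
apply: lyndon_lt_suffix; first by rewrite cat_take_drop.
  move/(congr1 size); have := congr1 size E; rewrite !size_cat => Es.
  rewrite size_takel => [/eqP|]; first by rewrite subn_eq0 leqNgt sz.
  by rewrite leq_subLR Es leq_addr.
by rewrite ut.
Qed.

Lemma lyndon_factors_lt u v : lyndon (u ++ v) -> lyndon u -> lyndon v -> u <l v.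
Proof.
move=> luv lu lv; have uvv := lyndon_lt_suffix luv (lyndon_neq0 lu) (lyndon_neq0 lv).
have [//|uv|vu] := lexlt_total u v.
  by rewrite uv prefix_sltFr ?prefix_prefix in uvv.
move: vu; rewrite lexltNge (le_trans (y := (u ++ v : seqlexi X))) //.
  by apply: prefix_lexle; exact: prefix_prefix.
by apply: ltW; exact: slt_lexlt.
Qed.

(** Suffixes of the least nonempty suffix are again suffixes of [r], hence larger, so the suffix
    criterion applies to it. *)
Lemma lyndon_min_suffix r : r <> [::] -> exists s t, [/\ r = t ++ s, lyndon s &
  forall s' t', s' <> [::] -> r = t' ++ s' -> s <=l s'].
Proof.
elim: r => // x r IH _; case: (eqVneq r [::]) => [->|/eqP/IH[s [t [rE ls smin]]]].
  exists [:: x], [::]; split=> //; first exact: lyndon1.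
  move=> s' [|y t'] s'0 /=; first by move=> <-.
  by case=> _; case: t' => //=; case: s' s'0.
have [lt_s|sE|lt_xr] := lexlt_total s (x :: r).
- exists s, (x :: t); split=> //; first by rewrite rE.
  move=> s' [|y t'] s'0 /=; last by move=> [_]; exact: smin.
  by move=> <-; exact/ltW.
- exists (x :: r), [::]; split=> //; first by rewrite -sE.
  move=> s' [|y t'] s'0 /=; last by move=> [_]; rewrite -sE; exact: smin.
  by move=> <-.
- exists (x :: r), [::]; split=> //.
    apply/lyndonP; split=> // -[|y u] v // _ v0 [_ /(smin _ _ v0)].
    exact: lt_le_lexlt.
  move=> s' [|y t'] s'0 /=; first by move=> <-.
  by move=> [_ /(smin _ _ s'0)] /(lt_le_lexlt lt_xr)/ltW.
Qed.

(* A nonempty [r] with [r ++ v'] Lyndon is shortened to its first Lyndon factor, which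
   is at least its minimal suffix. *)
Lemma lyndon_left_factor u v r v' : v = r ++ v' -> lyndon v -> lyndon v' ->
  r <> [::] -> (forall s t, lyndon s -> r = t ++ s -> u <l s) ->
  exists r1 v1, [/\ v = r1 ++ v1, lyndon r1, lyndon v1 & u <l r1].
Proof.
move: {2}(size r) (leqnn (size r)) => n; elim: n r v' => [|n IH] r v'.
  by rewrite leqn0 size_eq0 => /eqP.
move=> szr vE lv lv' r0 ur.
have [s [t [rE ls smin]]] := lyndon_min_suffix r0.
case: (eqVneq t [::]) => [t0|/eqP t0].
  by exists r, v'; split=> //; [rewrite rE t0 | apply: (ur _ [::] _ erefl); rewrite rE t0].
have sr : s <=l r by apply: (smin r [::]).
have rv' : r <l v'.
  apply: (@le_lt_trans _ (seqlexi X) v).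
    by rewrite vE; apply: prefix_lexle; exact: prefix_prefix.
  apply: slt_lexlt; rewrite {1}vE; apply: lyndon_lt_suffix; rewrite -?vE //.
  exact: lyndon_neq0.
have sv' : s <l v' by apply: le_lt_trans sr rv'.
(* The minimal suffix [s] of [r] moves over to [v']; since [s <= r <= v < v'], the word [s v'] is
   again Lyndon. *)
apply: (IH t (s ++ v')) => //.
- by rewrite -ltnS; apply: leq_trans szr; rewrite rE size_cat -addn1 leq_add2l lt0n
   size_eq0; apply/eqP; exact: lyndon_neq0.
- by rewrite vE rE catA.
- exact: lyndon_cat.
(* A Lyndon suffix [s' < s] of [t] would make [s' s] a suffix of [r] below the minimal one. *)
move=> s' t' ls' tE; apply: (lt_le_lexlt (ur s t ls rE)).
have [s's|<-//|] := lexlt_total s' s; last exact: ltW.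
have := slt_lexlt (lyndon_slt_cat ls' ls s's).
rewrite lexltNge (smin _ t') //; last by rewrite rE tE catA.
by case: (s') (lyndon_neq0 ls').
Qed.

(** * The Lyndon basis is a Hall set *)

Local Notation B := (@lyndon_basis d X).

Lemma letter_neq_cat x u v : u <> [::] -> v <> [::] -> [:: x] <> u ++ v.
Proof. by case: u v => [|y [|z u]] [|t v]. Qed.

Lemma is_br_foliage w (t : Br X) : is_br w t -> foliage t = w /\ lyndon w.
Proof.
elim=> [x|{}w u v t1 t2 [wE lw _ _ _] _ [f1 _] _ [f2 _]] /=.
  by split=> //; exact: lyndon1.
by rewrite f1 f2.
Qed.

Lemma lyndon_basisE (t : Br X) : B t <-> is_br (foliage t) t.
Proof.
split=> [[w [_ wt]]|ft]; first by have [-> _] := is_br_foliage wt.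
by exists (foliage t); have [] := is_br_foliage ft.
Qed.

Lemma lyndon_foliage (t : Br X) : B t -> lyndon (foliage t).
Proof. by move/lyndon_basisE/is_br_foliage => []. Qed.

Lemma lyndon_basis_leaf x : B (Leaf x).
Proof. by apply/lyndon_basisE; exact: is_br_leaf. Qed.

(** Maximality fixes the length of the left factor, hence the standard factorization. *)
Lemma is_br_inj w (s t : Br X) : is_br w s -> is_br w t -> s = t.
Proof.
move=> ws; elim: ws t => [x t xt|{}w u v s1 s2 [wE lw lu lv max] _ IH1 _ IH2 t wt].
  inversion xt as [|? u v ? ? [E lw lu lv max]] => //; subst.
  by case: (letter_neq_cat (lyndon_neq0 lu) (lyndon_neq0 lv) E).
inversion wt as [? E|? u' v' t1 t2 [wE' _ lu' lv' max'] ut vt]; subst.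
  by case: (letter_neq_cat (lyndon_neq0 lu) (lyndon_neq0 lv) E).
have szu : size u = size u'.
  by apply: anti_leq; rewrite (max' u v) //= (max _ _ wE').
move/eqP: wE'; rewrite eqseq_cat // => /andP[/eqP uu /eqP vv]; subst.
by rewrite (IH1 t1) // (IH2 t2).
Qed.

Lemma foliage_inj (s t : Br X) : B s -> B t -> foliage s = foliage t -> s = t.
Proof.
by move=> /lyndon_basisE ws /lyndon_basisE wt E; apply: is_br_inj ws _; rewrite E.
Qed.

(** The Hall condition on the left factor of [b], true for letters, with an arbitrary word in place
    of a bracket so that [bracket_support] can quantify over words. *)
Definition left_le (b : Br X) p : bool :=
  if b is Node b1 _ then foliage b1 <=l p else true.

(** If [b2 = (c1, c2)] with [b1 < c1], then [b1 c1] would be a longer Lyndon left factor. *)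
Lemma lyndon_basis_node_inv (b1 b2 : Br X) : B (Node b1 b2) ->
  [/\ B b1, B b2, hall_lt b1 b2 & left_le b2 (foliage b1)].
Proof.
move/lyndon_basisE => br; inversion br as [|w u v t1 t2 [wE lw lu lv max] br1 br2]; subst.
have [Eu _] := is_br_foliage br1; have [Ev _] := is_br_foliage br2.
subst u v; split; [exact/lyndon_basisE|exact/lyndon_basisE| |].
  by apply: lyndon_factors_lt; rewrite // -wE.
case: b2 br br2 lw lv max wE => //= c1 c2 br br2 lw lv max wE.
inversion br2 as [|w u v t1 t2 [vE _ lc1 lc2 _] br3 br4]; subst.
have [E1 _] := is_br_foliage br3; have [E2 _] := is_br_foliage br4; subst u v.
rewrite leNgt; apply/negP => b1c1; have l1 := lyndon_cat lu lc1 b1c1.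
have := max _ _ (catA _ _ _) l1 lc2.
rewrite size_cat -[leqRHS]addn0 leq_add2l leqn0 size_eq0 => /eqP.
exact: lyndon_neq0.
Qed.

(** A longer Lyndon left factor [b1 r] would cut [b2] inside. Then [b2] has a Lyndon left factor
    above [b1], and so its standard left factor is above [b1] too, against [left_le]. *)
Lemma lyndon_basis_node (b1 b2 : Br X) : B b1 -> B b2 -> hall_lt b1 b2 ->
  left_le b2 (foliage b1) -> B (Node b1 b2).
Proof.
move=> B1 B2 b12 b2b1; have l1 := lyndon_foliage B1; have l2 := lyndon_foliage B2.
apply/lyndon_basisE; apply: (@is_br_node _ _ _ (foliage b1) (foliage b2));
  [|exact/lyndon_basisE|exact/lyndon_basisE].
split=> // [|u' v' E lu' lv']; first exact: lyndon_cat.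
rewrite leqNgt; apply/negP => lt_u'.
pose r := drop (size (foliage b1)) u'.
have u'E : u' = foliage b1 ++ r.
  rewrite -[LHS](cat_take_drop (size (foliage b1))) -/r; congr (_ ++ _).
  have := congr1 (take (size (foliage b1))) E.
  by rewrite /= take_size_cat // takel_cat // ltnW.
have vE : foliage b2 = r ++ v'.
  by move: E => /= /eqP; rewrite u'E -catA eqseq_cat // eqxx => /eqP.
have r0 : r <> [::] by move=> r0; rewrite u'E r0 cats0 ltnn in lt_u'.
(* Such an [s] is a proper suffix of the Lyndon word [u' = b1 r], so [b1 < u' < s]. *)
have ur s t : lyndon s -> r = t ++ s -> foliage b1 <l s.
  move=> /lyndon_neq0 s0 rE; apply: (@lexlt_trans _ u').
    by rewrite u'E -{1}[foliage b1]cats0 lexlt_catl lexlt0l; exact/eqP.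
  rewrite u'E rE catA; apply/slt_lexlt/lyndon_lt_suffix => //.
    by rewrite -catA -rE -u'E.
  by case: (foliage b1) (lyndon_neq0 l1).
have [r1 [v1 [v1E lr1 lv1 ur1]]] := lyndon_left_factor vE l2 lv' r0 ur.
move/lyndon_basisE: B2 b2b1 => br2; clear ur r0 vE u'E lt_u'; clearbody r.
inversion br2 as [x E1|w u v t1 t2 [wE _ lu lv max] br3 br4]; subst.
  by move=> _; case: (letter_neq_cat (lyndon_neq0 lr1) (lyndon_neq0 lv1) v1E).
have [E1 _] := is_br_foliage br3; have [E2 _] := is_br_foliage br4; subst u v.
rewrite /= => t1b1; have := max _ _ v1E lr1 lv1 => sz.
(* By maximality of [t1] in the standard factorization, [r1] is not longer than [t1]. *)
have r1t1 : prefix r1 (foliage t1).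
  apply/prefixP; exists (drop (size r1) (foliage t1)).
  rewrite -[LHS](cat_take_drop (size r1)); congr (_ ++ _).
  have := congr1 (take (size r1)) v1E.
  by rewrite /= (take_size_cat _ (erefl (size r1))) takel_cat.
move: ur1; rewrite lexltNge (le_trans (prefix_lexle r1t1)) //.
Qed.
End Words.

(** * Linear independence *)

Section Series.
Context (K : comNzRingType) (X : choiceType).

(* Noncommutative formal power series, in place of the free associative algebra: the
   Lyndon brackets are already independent there and no finite support has to be kept. *)
Definition series : Type := seq X -> K^o.
HB.instance Definition _ := GRing.Lmodule.on series.
Implicit Types (f g h : seq X -> K) (w : seq X).

(** Cauchy product, the sum of [f u * g v] over all factorisations [w = u v]; the recursion moves
    the first letter of [w] into the argument of [f]. *)
Fixpoint conv f g w : K :=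
  if w is x :: w' then f [::] * g w + conv (fun v => f (x :: v)) g w'
  else f [::] * g [::].

Lemma conv_linearl a f g h w :
  conv (fun v => a * f v + g v) h w = a * conv f h w + conv g h w.
Proof.
by elim: w f g => /= [|x w IH] f g; rewrite ?IH; ring.
Qed.

Lemma conv_linearr a f g h w :
  conv h (fun v => a * f v + g v) w = a * conv h f w + conv h g w.
Proof.
by elim: w h => /= [|x w IH] h; rewrite ?IH; ring.
Qed.

Lemma convA f g h w : conv f (conv g h) w = conv (conv f g) h w.
Proof.
elim: w f g => /= [|x w IH] f g; first by ring.
by rewrite conv_linearl IH; ring.
Qed.

Definition commutator (f g : series) : series := fun w => conv f g w - conv g f w.

Lemma commutator_linearl (g : series) : linear (commutator^~ g).
Proof.
move=> a f h; apply/funext => w.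
rewrite -[RHS]/(a * (conv f g w - conv g f w) + (conv h g w - conv g h w)).
by rewrite /commutator conv_linearl conv_linearr; ring.
Qed.

Lemma commutator_linearr (f : series) : linear (commutator f).
Proof.
move=> a g h; apply/funext => w.
rewrite -[RHS]/(a * (conv f g w - conv g f w) + (conv f h w - conv h f w)).
by rewrite /commutator conv_linearl conv_linearr; ring.
Qed.

Lemma commutator_alt (f : series) : commutator f f = 0.
Proof. by apply/funext => w; rewrite /commutator subrr. Qed.

Lemma convBl f g h w : conv (fun v => f v - g v) h w = conv f h w - conv g h w.
Proof.
have := conv_linearl (-1) g f h w; rewrite mulN1r addrC => <-.
by congr (conv _ _ _); apply/funext => v; rewrite mulN1r addrC.
Qed.

Lemma convBr f g h w : conv h (fun v => f v - g v) w = conv h f w - conv h g w.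
Proof.
have := conv_linearr (-1) g f h w; rewrite mulN1r addrC => <-.
by congr (conv _ _ _); apply/funext => v; rewrite mulN1r addrC.
Qed.

Lemma commutator_jacobi (f g h : series) :
  commutator f (commutator g h) + commutator g (commutator h f) +
  commutator h (commutator f g) = 0.
Proof.
apply/funext => w; rewrite -[RHS]/(0 : K).
rewrite -[LHS]/(commutator f (commutator g h) w + commutator g (commutator h f) w +
  commutator h (commutator f g) w).
by rewrite /commutator !convBl !convBr !convA; ring.
Qed.

HB.instance Definition _ := Lmodule_isLieAlgebra.Build K series
  commutator_linearl commutator_linearr commutator_alt commutator_jacobi.

(** Only the factorisation with a left part of length [n] contributes. *)
Lemma conv_homogeneous n f g w : (forall v, size v <> n -> f v = 0) ->
  conv f g w = if (n <= size w)%N then f (take n w) * g (drop n w) else 0.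
Proof.
elim: w n f => [|x w IH] [|n] f fn /=; rewrite ?mul0r //.
- by rewrite fn // mul0r.
- rewrite (IH 0%N) => [|v _]; last exact: fn.
  by rewrite /= (fn (x :: _)) // mul0r addr0.
- by rewrite fn // mul0r add0r (IH n) ?ltnS // => v /eqP vn; apply: fn; apply/eqP.
Qed.

Definition letter (x : X) : series := fun w => (w == [:: x])%:R.

Local Notation evs := (@ev K X series letter).

Lemma ev_series_homogeneous t w : size w <> size (foliage t) -> evs t w = 0.
Proof.
elim: t w => [x|t1 IH1 t2 IH2] w /= wt.
  by rewrite /letter; case: eqP wt => // ->.
rewrite -[LHS]/(conv (evs t1) (evs t2) w - conv (evs t2) (evs t1) w).
rewrite (conv_homogeneous _ _ IH1) (conv_homogeneous _ _ IH2).
rewrite size_cat in wt.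
case: leqP => [le1|_]; last first.
  case: leqP => le2; rewrite ?subr0 // IH1 ?mulr0 ?subr0 //.
  by rewrite size_drop => E; apply: wt; rewrite -E subnK.
rewrite (IH2 (drop _ w)) ?mulr0 ?sub0r; last first.
  by rewrite size_drop => E; apply: wt; rewrite -E subnKC.
case: leqP => le2; rewrite ?oppr0 // IH1 ?mulr0 ?oppr0 //.
by rewrite size_drop => E; apply: wt; rewrite -E subnK.
Qed.

Lemma ev_series_node t1 t2 w : size w = (size (foliage t1) + size (foliage t2))%N ->
  evs (Node t1 t2) w =
  evs t1 (take (size (foliage t1)) w) * evs t2 (drop (size (foliage t1)) w) -
  evs t2 (take (size (foliage t2)) w) * evs t1 (drop (size (foliage t2)) w).
Proof.
move=> wE; rewrite -[LHS]/(conv (evs t1) (evs t2) w - conv (evs t2) (evs t1) w).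
rewrite (conv_homogeneous _ _ (@ev_series_homogeneous t1)).
rewrite (conv_homogeneous _ _ (@ev_series_homogeneous t2)).
by rewrite wE leq_addr leq_addl.
Qed.

End Series.

Lemma ev_morphism (K : pzRingType) (X : Type) (L M : lieAlgType K)
    (iota : X -> L) (g : L -> M) (t : Br X) :
  lie_morphism g -> g (ev iota t) = ev (g \o iota) t.
Proof.
by move=> [_ gl]; elim: t => //= t1 IH1 t2 IH2; rewrite gl IH1 IH2.
Qed.

Lemma sum_fibers (V : nmodType) (I : eqType) (T : choiceType) (r : seq I)
    (F : I -> V) (t : I -> T) (S : {fset T}) :
  (forall i, i \in r -> t i \in S) ->
  \sum_(i <- r) F i = \sum_(c <- S) \sum_(i <- r | t i == c) F i.
Proof.
move=> tS; rewrite (exchange_big_dep predT) //= big_seq [RHS]big_seq.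
apply: eq_bigr => i /tS tiS.
under eq_bigl do rewrite eq_sym.
by rewrite (@fbig_pred1_inj _ _ _ T T (fun=> F i) id S (t i)).
Qed.

(** * Triangularity of the Lyndon brackets, uniqueness of coordinates and the norm *)

Section Independence.
Context (K : numFieldType) (d : Order.disp_t) (X : orderType d).
Local Notation B := (@lyndon_basis d X).
Local Notation "u <=l v" := ((u : seqlexi X) <= (v : seqlexi X))%O (at level 70).
Local Notation evs := (@ev K X (series K X) (@letter K X)).

(** With [u], [v] the words of [t1], [t2], the product [t1 t2] starts at [u v] and [t2 t1] at [v u],
    which is larger by the definition of a Lyndon word. *)
Lemma ev_series_lyndon (t : Br X) : B t -> evs t (foliage t) = 1 /\
  forall w, evs t w != 0 -> foliage t <=l w.
Proof.
elim: t => [x _|t1 IH1 t2 IH2 Bt].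
  split=> [|w]; first by rewrite /= /letter eqxx.
  by rewrite /= /letter; case: (w =P [:: x]) => [-> _|_ /eqP].
have [B1 B2 _ _] := lyndon_basis_node_inv Bt.
have [{}IH1 le1] := IH1 B1; have [{}IH2 le2] := IH2 B2.
have [_ lt] := lyndon_foliage Bt.
have {}lt := lt _ _ (lyndon_neq0 (lyndon_foliage B1)) (lyndon_neq0 (lyndon_foliage B2)) erefl.
have le_rev w : size w = (size (foliage t1) + size (foliage t2))%N ->
    evs t2 (take (size (foliage t2)) w) * evs t1 (drop (size (foliage t2)) w) != 0 ->
    lexlt (foliage (Node t1 t2)) w.
  move=> wE; rewrite mulf_eq0 negb_or => /andP[/le2 l2 /le1 l1].
  apply: lt_le_lexlt lt _; rewrite -(cat_take_drop (size (foliage t2)) w).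
  by rewrite lexle_cat // size_takel // wE leq_addl.
split=> [|w w0].
  rewrite ev_series_node ?size_cat // take_size_cat // drop_size_cat // IH1 IH2 mulr1.
  apply/eqP; rewrite subr_eq addrC -subr_eq subrr eq_sym; apply/negPn/negP.
  by move/le_rev; rewrite size_cat lexltxx => /(_ erefl).
have wE : size w = (size (foliage t1) + size (foliage t2))%N.
  apply/eqP; rewrite -size_cat; apply: contraNT w0 => /eqP wt.
  by apply/eqP; exact: ev_series_homogeneous.
move: w0; rewrite ev_series_node //.
have [E0|+ _] := eqVneq (evs t2 (take (size (foliage t2)) w) *
  evs t1 (drop (size (foliage t2)) w)) 0; last by move/(le_rev w wE)/ltW.
rewrite E0 subr0 mulf_eq0 negb_or => /andP[/le1 l1 /le2 l2].
by rewrite -(cat_take_drop (size (foliage t1)) w) lexle_cat // size_takel // wE leq_addr.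
Qed.

Context (L : lieAlgType K) (iota : X -> L) (hL : free_lie iota).

(** The universal property transports the relation to power series, where it can be read word by
    word. *)
Lemma lyndon_basis_free (S : {fset Br X}) (a : Br X -> K) :
  (forall c, c \in S -> B c) -> \sum_(c <- S) a c *: ev iota c = 0 ->
  forall c, c \in S -> a c = 0.
Proof.
move=> SB sum0; have [g [gm gi _]] := hL (@letter K X).
have ga c : g (ev iota c) = evs c.
  by rewrite ev_morphism //; congr (ev _ c); apply/funext.
have gD : {morph g : x y / x + y} by move=> x y; have := gm.1 1 x y; rewrite !scale1r.
have g0 : g 0 = 0 by apply: (addrI (g 0)); rewrite -gD !addr0.
have gZ k x : g (k *: x) = k *: g x by have := gm.1 k x 0; rewrite g0 !addr0.
have sumw w : \sum_(c <- S) a c * evs c w = 0.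
  pose at_w (f : series K X) : K := f w.
  have wD : {morph at_w : f1 f2 / f1 + f2} by [].
  have w0 : at_w 0 = 0 by [].
  have := congr1 (at_w \o g) sum0.
  rewrite /= g0 (big_morph g gD g0) (big_morph at_w wD w0) w0 => E; rewrite -[RHS]E.
  by apply: eq_bigr => c _; rewrite gZ ga.
move=> c cS; apply/eqP; apply: contraT => ac.
(* Take a bracket with least foliage among those of nonzero coefficient: at that word no other term
   contributes. *)
pose i0 : S := [` cS]%fset.
have [i ai imin] := @Order.TotalTheory.arg_minP _ (seqlexi X) S i0
  (fun i => a (val i) != 0) (fun i => foliage (val i)) ac.
have Bi := SB _ (valP i).
have := sumw (foliage (val i)); rewrite (big_rem (val i)) ?valP //=.
rewrite (ev_series_lyndon Bi).1 mulr1 big_seq big1 ?addr0 => [/eqP|c'].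
  by rewrite (negbTE ai).
rewrite (mem_rem_uniq _ (fset_uniq S)) => /andP[/= c'i c'S].
have [->|ac'] := eqVneq (a c') 0; first by rewrite mul0r.
have [->|ec'] := eqVneq (evs c' (foliage (val i))) 0; first by rewrite mulr0.
case/eqP: c'i; apply: foliage_inj; [exact: SB|exact: Bi|apply: (@le_anti _ (seqlexi X))].
rewrite (ev_series_lyndon (SB _ c'S)).2 //=.
exact: (imin [` c'S]%fset ac').
Qed.

(** This makes the choice by [xget] in [coef] return the actual coordinates. *)
Lemma lyndon_decomposition_inj u (a b : {fsfun Br X -> K with 0}) :
  decomposition iota B u a -> decomposition iota B u b -> a = b.
Proof.
move=> [aB aE] [bB bE]; apply/fsfunP => c.
pose S := (finsupp a `|` finsupp b)%fset.
have SB c' : c' \in S -> B c' by rewrite inE => /orP[/aB|/bB].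
have extend (f : {fsfun Br X -> K with 0}) : (finsupp f `<=` S)%fset ->
    \sum_(c <- finsupp f) f c *: ev iota c = \sum_(c <- S) f c *: ev iota c.
  by move=> fS; apply: big_fset_incl => // x _ /fsfun_dflt ->; rewrite scale0r.
rewrite extend ?fsubsetUl // in aE; rewrite extend ?fsubsetUr // in bE.
have := @lyndon_basis_free S (fun c => a c - b c) SB.
have -> : \sum_(c <- S) (a c - b c) *: ev iota c = 0.
  rewrite (eq_bigr (fun c => a c *: ev iota c - b c *: ev iota c)).
    by rewrite sumrB -aE -bE subrr.
  by move=> x _; rewrite scalerBl.
move=> /(_ erefl c); case: (boolP (c \in S)) => [_ /(_ erefl)/eqP|].
  by rewrite subr_eq0 => /eqP.
by rewrite inE negb_or => /andP[ca cb] _; rewrite !fsfun_dflt.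
Qed.

(** The family may repeat brackets, so the coordinate at [c] is a sum over the fibre of [t]. *)
Lemma hall_norm_sum (I : eqType) (r : seq I) (k : I -> K) (t : I -> Br X)
    (S : {fset Br X}) :
  (forall c, c \in S -> B c) -> (forall i, i \in r -> t i \in S) ->
  hall_norm iota B (\sum_(i <- r) k i *: ev iota (t i)) =
  \sum_(c <- S) `|\sum_(i <- r | t i == c) k i|.
Proof.
move=> SB tS; set u := \sum_(i <- r) _.
pose a : {fsfun Br X -> K with 0} :=
  [fsfun c in S => \sum_(i <- r | t i == c) k i | 0].
have aE c : c \in S -> a c = \sum_(i <- r | t i == c) k i.
  by move=> cS; rewrite fsfun_fun cS.
have aS : (finsupp a `<=` S)%fset by exact: finsupp_sub.
have extend (V : nmodType) (F : Br X -> V) : (forall c, a c = 0 -> F c = 0) ->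
    \sum_(c <- finsupp a) F c = \sum_(c <- S) F c.
  by move=> F0; apply: big_fset_incl => // x _ /fsfun_dflt/F0.
have aP : decomposition iota B u a.
  split=> [c /(fsubsetP aS)/SB//|]; rewrite extend => [|c ->]; last exact: scale0r.
  rewrite /u (sum_fibers _ tS) !big_seq; apply: eq_bigr => c /aE ->.
  by rewrite scaler_suml; apply: eq_bigr => i /eqP ->.
have -> : hall_norm iota B u = \sum_(c <- finsupp a) `|a c|.
  by rewrite /hall_norm /coef (xget_unique _ aP) // => b /lyndon_decomposition_inj; apply.
rewrite extend => [|c ->]; last exact: normr0.
by rewrite !big_seq; apply: eq_bigr => c /aE ->.
Qed.

(** Cancellation inside a fibre can only lower the norm. *)
Lemma hall_norm_le (I : eqType) (r : seq I) (k : I -> K) (t : I -> Br X) :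
  (forall i, i \in r -> B (t i)) ->
  hall_norm iota B (\sum_(i <- r) k i *: ev iota (t i)) <= \sum_(i <- r) `|k i|.
Proof.
move=> Bt; pose S := [fset c in map t r]%fset.
have tS i : i \in r -> t i \in S by move=> ir; rewrite inE map_f.
rewrite (@hall_norm_sum _ r k t S) //; last by move=> c; rewrite inE => /mapP[i /Bt ? ->].
by rewrite (sum_fibers _ tS); apply: ler_sum => c _; exact: ler_norm_sum.
Qed.

Lemma hall_norm_inj (I : finType) (k : I -> K) (t : I -> Br X) :
  injective t -> (forall i, B (t i)) ->
  hall_norm iota B (\sum_i k i *: ev iota (t i)) = \sum_i `|k i|.
Proof.
move=> tinj Bt; pose S := [fset c in codom t]%fset.
have tS i : t i \in S by rewrite inE codom_f.
rewrite (@hall_norm_sum _ _ k t S) //; last by move=> c; rewrite inE => /codomP[i ->].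
rewrite (@sum_fibers _ _ _ _ (fun i => `|k i|) t S) // !big_seq.
apply: eq_bigr => c; rewrite inE => /codomP[i ->].
by rewrite !(big_pred1 i) // => j; rewrite /= (inj_eq tinj).
Qed.

End Independence.

(** * Brackets of Lyndon basis elements *)

Section LieTheory.
Context (K : pzRingType) (L : lieAlgType K).
Implicit Types u v w : L.

Lemma lieDl u v w : lie (u + v) w = lie u w + lie v w.
Proof. by have := lie_linearl w 1 u v; rewrite !scale1r. Qed.

Lemma lieDr u v w : lie w (u + v) = lie w u + lie w v.
Proof. by have := lie_linearr w 1 u v; rewrite !scale1r. Qed.

Lemma lie0l u : lie 0 u = 0.
Proof. by apply: (addrI (lie 0 u)); rewrite -lieDl !addr0. Qed.

Lemma lie0r u : lie u 0 = 0.
Proof. by apply: (addrI (lie u 0)); rewrite -lieDr !addr0. Qed.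

Lemma lieZl k u v : lie (k *: u) v = k *: lie u v.
Proof. by have := lie_linearl v k u 0; rewrite lie0l !addr0. Qed.

Lemma lieZr k u v : lie u (k *: v) = k *: lie u v.
Proof. by have := lie_linearr u k v 0; rewrite lie0r !addr0. Qed.

Lemma lieC u v : lie u v = - lie v u.
Proof.
have := lie_alt (u + v); rewrite lieDl !lieDr !lie_alt add0r addr0.
by move/eqP; rewrite addr_eq0 => /eqP.
Qed.

Lemma lieNr u v : lie u (- v) = - lie u v.
Proof. by rewrite -!scaleN1r lieZr. Qed.

Lemma lie_leibniz u v w : lie u (lie v w) = lie (lie u v) w + lie v (lie u w).
Proof.
have /eqP := lie_jacobi u v w; rewrite -addrA addr_eq0 => /eqP ->.
by rewrite opprD addrC (lieC w (lie u v)) opprK (lieC w u) lieNr opprK.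
Qed.

Definition lie_right v u := lie u v.

(** Jacobi reads [[u, [y, w]] = [[u, y], w] - [[u, w], y]]: each of the [n] copies of [y] goes onto
    [u], or outside with a sign. *)
Lemma lie_iter_ad n u y v :
  lie u (iter n (lie y) v) =
  \sum_(i < n.+1) ((-1) ^+ (n - i) *+ 'C(n, i)) *:
    iter (n - i) (lie_right y) (lie (iter i (lie_right y) u) v).
Proof.
elim: n u => [|n IH] u; first by rewrite big_ord1 /= mulr1n scale1r.
pose T i j := iter j (lie_right y) (lie (iter i (lie_right y) u) v).
have E1 : lie (lie u y) (iter n (lie y) v) =
    \sum_(i < n.+1) ((-1) ^+ (n - i) *+ 'C(n, i)) *: T i.+1 (n - i)%N.
  by rewrite -[lie u y]/(lie_right y u) IH; apply: eq_bigr => i _; rewrite /T iterSr.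
have E2 : lie y (lie u (iter n (lie y) v)) =
    - \sum_(i < n.+1) ((-1) ^+ (n - i) *+ 'C(n, i)) *: T i (n - i).+1%N.
  rewrite lieC IH; congr (- _).
  have -> (I : finType) (F : I -> L) : lie (\sum_i F i) y = \sum_i lie (F i) y.
    exact: (big_morph (lie^~ y) (fun a b => lieDl a b y) (lie0l y)).
  by apply: eq_bigr => i _; rewrite lieZl.
rewrite iterS lie_leibniz E1 E2 [RHS]big_ord_recl.
(* Pascal's rule splits each coefficient: the second part is [E1], and the first is [E2] after an
   index shift, its last term vanishing with ['C(n, n.+1)]. *)
rewrite [X in _ = _ + X](eq_bigr (fun i : 'I_n.+1 =>
    ((-1) ^+ (n - i) *+ 'C(n, i.+1)) *: T i.+1 (n - i)%N +
    ((-1) ^+ (n - i) *+ 'C(n, i)) *: T i.+1 (n - i)%N)); last first.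
  by move=> i _; rewrite lift0 subSS binS mulrnDr scalerDl.
rewrite big_split /= [RHS]addrA [RHS]addrC; congr (_ + _).
rewrite big_ord_recl [X in _ = _ + X]big_ord_recr /= (bin_small (ltnSn n)) mulr0n scale0r addr0.
rewrite opprD !bin0 !subn0 exprS mulN1r scaleNr; congr (_ + _).
rewrite -sumrN; apply: eq_bigr => i _; rewrite /bump leq0n add1n -(subnSK (ltn_ord i)).
by rewrite exprS mulN1r mulNrn scaleNr.
Qed.

End LieTheory.

(** * Linear combinations of brackets with bounded coefficient sum *)

Section Combination.
Context (K : numFieldType) (X : choiceType) (L : lieAlgType K) (iota : X -> L).
Implicit Types (P Q : Br X -> Prop) (N M : K) (u v : L).

(** A list may repeat a bracket, so sums are concatenations and the bounds simply add up. *)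
Definition combination P N u : Prop := exists s : seq (K * Br X),
  [/\ forall p, p \in s -> P p.2, u = \sum_(p <- s) p.1 *: ev iota p.2 &
      \sum_(p <- s) `|p.1| <= N].

Lemma combinationW P Q N M u : (forall c, P c -> Q c) -> N <= M ->
  combination P N u -> combination Q M u.
Proof.
move=> PQ NM [s [sP -> sN]]; exists s; split=> // [p /sP/PQ //|].
exact: le_trans NM.
Qed.

Lemma combination_ev P c : P c -> combination P 1 (ev iota c).
Proof.
move=> Pc; exists [:: (1, c)]; split=> [p||]; rewrite ?big_seq1 ?scale1r ?normr1 //.
by rewrite inE => /eqP ->.
Qed.

Lemma combination0 P : combination P 0 0.
Proof. by exists [::]; split; rewrite ?big_nil. Qed.

Lemma combinationD P N M u v :
  combination P N u -> combination P M v -> combination P (N + M) (u + v).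
Proof.
move=> [s [sP -> sN]] [t [tP -> tM]]; exists (s ++ t); rewrite !big_cat.
by split=> [p||//]; rewrite ?mem_cat ?lerD // => /orP[/sP|/tP].
Qed.

Lemma combinationZ P N k u :
  combination P N u -> combination P (`|k| * N) (k *: u).
Proof.
move=> [s [sP -> sN]]; exists [seq (k * p.1, p.2) | p <- s].
split=> [p /mapP[q /sP qP ->]//||].
  by rewrite big_map scaler_sumr; apply: eq_bigr => p _; rewrite scalerA.
rewrite big_map (eq_bigr (fun p => `|k| * `|p.1|)) => [|p _]; last exact: normrM.
by rewrite -mulr_sumr ler_wpM2l.
Qed.

Lemma combinationN P N u : combination P N u -> combination P N (- u).
Proof. by move/(combinationZ (-1)); rewrite normrN1 mul1r scaleN1r. Qed.

Lemma combination_bind P Q N M (f : L -> L) u : linear f -> 0 <= M ->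
  (forall c, P c -> combination Q M (f (ev iota c))) ->
  combination P N u -> combination Q (N * M) (f u).
Proof.
move=> flin M0 fQ [s [sP -> sN]].
apply: (combinationW (N := (\sum_(p <- s) `|p.1|) * M)) (fun _ => id) _ _.
  exact: ler_wpM2r.
have f0 : f 0 = 0.
  by apply: (addrI (f 0)); have := flin 1 0 0; rewrite !scale1r !addr0 => <-.
elim: s sP {sN} => [|p s IH] sP; first by rewrite !big_nil f0 mul0r; exact: combination0.
rewrite !big_cons flin mulrDl; apply: combinationD.
  by apply/combinationZ/fQ/sP; rewrite mem_head.
by apply: IH => q qs; apply: sP; rewrite in_cons qs orbT.
Qed.

End Combination.

(** * The recursive bound on the bracket of two Lyndon basis elements *)

Section Bracket.
Context (d : Order.disp_t) (X : orderType d) (K : numFieldType).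
Context (L : lieAlgType K) (iota : X -> L).
Local Notation B := (@lyndon_basis d X).
Local Notation "u <=l v" := ((u : seqlexi X) <= (v : seqlexi X))%O (at level 70).
Implicit Types (a b c : Br X) (p : seq X).

Lemma left_leW b p q : p <=l q -> left_le b p -> left_le b q.
Proof. by case: b => //= b1 b2 pq b1p; exact: le_trans pq. Qed.

Lemma left_le_self b p : foliage b <=l p -> left_le b p.
Proof.
case: b => //= b1 b2; apply: le_trans; apply: prefix_lexle; exact: prefix_prefix.
Qed.

(* Closure properties of the support of [a, b] that make the recursion
   [a, (b', b'')] = [[a, b'], b''] + [b', [a, b'']] stop on [b'] and [b'']. *)
Definition bracket_support a b c : Prop :=
  [/\ B c, slt (foliage c) (foliage b),
      forall p, foliage a <=l p -> left_le b p -> left_le c p &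
      forall p, slt (foliage a) p -> left_le b p -> slt (foliage c) p].

Lemma bracket_support_node a b : B a -> B b -> hall_lt a b ->
  left_le b (foliage a) -> bracket_support a b (Node a b).
Proof.
move=> Ba Bb ab ba; split=> //=; first exact: lyndon_basis_node.
  by apply: lyndon_slt_cat => //; exact: lyndon_foliage.
by move=> p ap _; rewrite -[p]cats0; exact: slt_catr.
Qed.

Context (W : Br X -> K) (W1 : forall b, 1 <= W b).
Context (W_node : forall a b' b'', B a -> B (Node b' b'') -> hall_lt a b' ->
  2 * (W b' * W b'') <= W (Node b' b'')).

(** The induction on [b] leaves [a] free, since the hypotheses are also applied to brackets [c] from
    earlier supports. *)
Lemma bracket_combination a b : B a -> B b -> hall_lt a b ->
  combination iota (bracket_support a b) (W b) (lie (ev iota a) (ev iota b)).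
Proof.
have W0 c : 0 <= W c by apply: le_trans (W1 c); exact: ler01.
elim: b a => [x|b' IH' b'' IH''] a Ba Bb ab.
  apply: combinationW (fun _ => id) (W1 _) (combination_ev _ (c := Node a (Leaf x)) _).
  exact: bracket_support_node.
have [ba|] := boolP (left_le (Node b' b'') (foliage a)).
  apply: combinationW (fun _ => id) (W1 _) (combination_ev _ (c := Node a (Node b' b'')) _).
  exact: bracket_support_node.
rewrite /= -ltNge -[(_ < _)%O]/(hall_lt a b') => ab'.
have [B' B'' b'b'' left_b''] := lyndon_basis_node_inv Bb.
rewrite /= lie_leibniz.
(* The bound is cut into two equal halves, one for each Jacobi term. *)
apply: combinationW (fun _ => id) (W_node Ba Bb ab') _.
rewrite -[2]/(1 + 1) mulrDl mul1r; apply: combinationD.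
  apply: combination_bind (lie_linearl _) (W0 b'') _ (IH' a Ba B' ab').
  move=> c [Bc cb' _ _].
  have cb'' : hall_lt c b'' by apply: lexlt_trans (slt_lexlt cb') b'b''.
  (* Since [slt c b'] on foliages, the closure properties of [e] apply at every [p >= b']; at
     [p = b'] they place [e] below [b' b'']. *)
  apply: combinationW (lexx _) (IH'' c Bc B'' cb'') => e [Be _ left_e slt_e].
  split=> // [|p ap b'p|p ap b'p].
  - by rewrite -[foliage e]cats0 /=; apply/slt_catr/slt_e.
  - apply: left_e; last exact: left_leW b'p left_b''.
    by apply: ltW; apply: lt_le_lexlt b'p; exact: slt_lexlt.
  - apply: slt_e; last exact: left_leW b'p left_b''.
    exact: slt_le_trans b'p.
rewrite mulrC.
apply: combination_bind (lie_linearr _) (W0 b') _ (IH'' a Ba B'' (lexlt_trans ab' b'b'')).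
move=> c [Bc cb'' left_c slt_c].
have [cb'|/foliage_inj-> //|b'c] := lexlt_total (foliage c) (foliage b').
- rewrite lieC; apply: combinationN.
  apply: combinationW (lexx _) (IH' c Bc B' cb') => e [Be eb' left_e slt_e].
  split=> // [|p ap b'p|p ap b'p].
  + by rewrite -[foliage e]cats0 /=; exact: slt_catr.
  + apply: left_e; last exact: left_le_self.
    by apply: ltW; apply: lt_le_lexlt b'p.
  + apply: slt_e; last exact: left_le_self.
    by apply: slt_c => //; exact: left_leW b'p left_b''.
- by rewrite lie_alt; apply: combinationW (fun _ => id) (W0 _) (combination0 _ _).
- apply: combinationW (W1 _) (combination_ev iota (P := eq (Node b' c)) erefl) => _ <-.
  split=> //=.
  (* The third closure property of [c], taken at the word of [b'], is the Hall condition for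
     [(b', c)]. *)
  + by apply: lyndon_basis_node => //; apply: left_c => //; exact: ltW.
  + by rewrite slt_catl.
  (* If [a] and [b'] differed at a position, [c < b'] would follow; so [a] is a prefix of [b']. As
     [a] and [p] do differ, [b'] is no prefix of [p], and [b' <= p] gives [slt b' p]. *)
  + move=> p ap b'p.
    have [sab'|] := boolP (slt (foliage a) (foliage b')).
      have := slt_lexlt (slt_c _ sab' left_b'').
      by rewrite (lexlt_asym b'c).
    move: (ab'); rewrite /hall_lt lexltE => /orP[->//|/andP[pab' _] _].
    move: b'p; rewrite le_eqVlt => /predU1P[b'p|].
      by rewrite -b'p prefix_sltF in ap.
    rewrite -[(_ < _)%O]/(lexlt _ _) lexltE => /orP[b'p|/andP[pb'p _]].
      by rewrite -[p]cats0; exact: slt_catr.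
    by rewrite (prefix_sltF (prefix_trans pab' pb'p)) in ap.
Qed.

End Bracket.

(** * Sharpness and explicit bounds *)

Section Sharpness.
Context (d : Order.disp_t) (X : orderType d) (K : numFieldType).
Context (L : lieAlgType K) (iota : X -> L).
Local Notation B := (@lyndon_basis d X).
Implicit Types (x y : X) (a z t : Br X) (n m : nat).

Lemma foliage_iter_ad_under y t n :
  foliage (iter n (ad_under (Leaf y)) t) = foliage t ++ nseq n y.
Proof.
elim: n => [|n IH] /=; first by rewrite cats0.
by rewrite IH -catA -[[:: y]]/(nseq 1 y) -nseqD addn1.
Qed.

Lemma ev_iter_ad y t n :
  ev iota (iter n (ad (Leaf y)) t) = iter n (lie (iota y)) (ev iota t).
Proof. by elim: n => //= n ->. Qed.

Lemma ev_iter_ad_under y t n :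
  ev iota (iter n (ad_under (Leaf y)) t) = iter n (lie_right (iota y)) (ev iota t).
Proof. by elim: n => //= n ->. Qed.

Lemma iter_lie_right (u v : L) n : iter n (lie_right u) v = (-1) ^+ n *: iter n (lie u) v.
Proof.
elim: n => [|n IH]; first by rewrite scale1r.
by rewrite !iterS IH /lie_right lieC lieZr exprS mulN1r scaleNr.
Qed.

Lemma iter_ad_under_lyndon y t n : B t -> slt (foliage t) [:: y] ->
  B (iter n (ad_under (Leaf y)) t).
Proof.
move=> Bt ty; elim: n => //= n IH.
apply: lyndon_basis_node => //; first exact: lyndon_basis_leaf.
apply: slt_lexlt; rewrite foliage_iter_ad_under -[foliage (Leaf y)]cats0.
exact: slt_catr.
Qed.

(** The brackets in the expansion [lie_iter_ad]; the word is [a y^i z y^(n-i)]. *)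
Definition two_step y z a n i : Br X :=
  iter (n - i) (ad_under (Leaf y)) (Node (iter i (ad_under (Leaf y)) a) z).

Lemma two_step_lyndon y z a n i : B a -> B z -> slt (foliage a) [:: y] ->
  slt (foliage a) (foliage z) -> left_le z (foliage a) -> B (two_step y z a n i).
Proof.
move=> Ba Bz ay az za; apply: iter_ad_under_lyndon.
  apply: lyndon_basis_node => //; first exact: iter_ad_under_lyndon.
    rewrite /hall_lt foliage_iter_ad_under -[foliage z]cats0.
    by apply: slt_lexlt; exact: slt_catr.
  apply: left_leW za; rewrite foliage_iter_ad_under.
  by apply: prefix_lexle; exact: prefix_prefix.
by rewrite /= foliage_iter_ad_under -catA -[[:: y]]cats0; exact: slt_catr.
Qed.

(** Since [z] is not the letter [y], the outer right factors [y] can be counted; this separates the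
    [two_step] brackets. *)
Lemma iter_ad_under_inj y z s1 s2 n m : z <> Leaf y ->
  iter n (ad_under (Leaf y)) (Node s1 z) = iter m (ad_under (Leaf y)) (Node s2 z) ->
  n = m.
Proof.
by move=> zy; elim: n m => [|n IH] [|m] //= [] => [_ /zy|_ /esym/zy|/IH ->].
Qed.

Context (hL : free_lie iota).

(** The brackets are distinct, so the norm is a sum of binomial coefficients. The scalar [k]
    accommodates the sign between left and right iterated brackets. *)
Lemma hall_norm_lie_iter_ad (k : K) y z a n : `|k| = 1 -> z <> Leaf y ->
  B a -> B z -> slt (foliage a) [:: y] ->
  slt (foliage a) (foliage z) -> left_le z (foliage a) ->
  hall_norm iota B (lie (ev iota a) (k *: iter n (lie (iota y)) (ev iota z))) = 2 ^+ n.
Proof.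
move=> k1 zy Ba Bz ay az za; rewrite lieZr lie_iter_ad scaler_sumr.
rewrite (eq_bigr (fun i : 'I_n.+1 =>
  (k * ((-1) ^+ (n - i) *+ 'C(n, i))) *: ev iota (two_step y z a n i))); last first.
  by move=> i _; rewrite scalerA /two_step ev_iter_ad_under /= ev_iter_ad_under.
rewrite hall_norm_inj //; last by move=> i; exact: two_step_lyndon.
  rewrite -[2]/(1 + 1) exprDn; apply: eq_bigr => i _.
  by rewrite normrM k1 mul1r normrMn normrX normrN1 !expr1n mulr1.
move=> i j /(iter_ad_under_inj zy) E; apply: val_inj.
by move: (leq_ord i) (leq_ord j) E => /=; lia.
Qed.

End Sharpness.

(** Either the first letter exceeds [x], or it is [x] and the last letter, a proper suffix, exceeds
    it. *)
Lemma lyndon_lt_letter (d : Order.disp_t) (X : orderType d) (x : X) (w : seq X) :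
  lyndon w -> lexlt [:: x] w -> exists2 z, z \in w & (x < z)%O.
Proof.
case: w => [|y w] lw; first by rewrite lexltl0.
rewrite lexlt_cons lexlt0l => /orP[xy|/andP[/eqP xy w0]].
  by exists y; rewrite ?mem_head.
subst y; case: (lastP w) w0 lw => // s z _ lw.
exists z; first by rewrite in_cons mem_rcons mem_head orbT.
have /= /orP[] // : slt ((x :: s) ++ [:: z]) [:: z].
  by apply: lyndon_lt_suffix; rewrite // cat_cons cats1.
by case/andP=> _; case: (s ++ _).
Qed.

(* In [Node (Leaf x) b], a Lyndon word below [x] starts with a letter below [x], and
   [b], being Lyndon and above [x], contains a letter above [x]. *)
Lemma lyndon_node_left_letter (d : Order.disp_t) (X : orderType d) (a b : Br X) (x : X) :
  lyndon_basis a -> lyndon_basis (Node (Leaf x) b) -> hall_lt a (Leaf x) ->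
  exists y z, (y < x)%O /\ (x < z)%O.
Proof.
move=> /lyndon_foliage la /lyndon_basis_node_inv[_ /lyndon_foliage lb xb _].
have [z _ xz] := lyndon_lt_letter lb xb.
rewrite /hall_lt; case: (foliage a) (lyndon_neq0 la) => // y w _.
rewrite lexlt_cons lexltl0 andbF orbF => yx.
by exists y, z.
Qed.

Lemma leaves_gt0 (X : Type) (t : Br X) : (0 < leaves t)%N.
Proof. by elim: t => //= t1 IH1 t2 IH2; rewrite /leaves size_cat addn_gt0 IH1. Qed.

(** * Upper bounds from explicit weights *)

Section Estimate.
Context (d : Order.disp_t) (X : orderType d) (K : numFieldType).
Context (L : lieAlgType K) (iota : X -> L) (hL : free_lie iota).
Local Notation B := (@lyndon_basis d X).

Lemma hall_norm_combination (P : Br X -> Prop) (N : K) u :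
  (forall c, P c -> B c) -> combination iota P N u -> hall_norm iota B u <= N.
Proof.
move=> PB [s [sP -> sN]]; apply: le_trans sN.
by apply: (hall_norm_le hL) => p /sP/PB.
Qed.

Lemma hall_norm_bracket_le (a b : Br X) : B a -> B b -> hall_lt a b ->
  hall_norm iota B (lie (ev iota a) (ev iota b)) <= 2 ^+ (leaves b - 1).
Proof.
move=> Ba Bb ab; apply: hall_norm_combination (_ : combination _ (bracket_support a b) _ _).
  by move=> c [].
apply: (@bracket_combination _ _ _ _ _ (fun b => 2 ^+ (leaves b - 1))) => //.
  by move=> t; rewrite exprn_ege1 // ler1n.
(* The exponents [1 + (|b'| - 1) + (|b''| - 1)] add up to [|b| - 1]. *)
move=> _ b' b'' _ _ _; rewrite -exprD -exprS; apply: ler_weXn2l; rewrite ?ler1n //.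
by have := leaves_gt0 b'; have := leaves_gt0 b''; rewrite /leaves /= size_cat; lia.
Qed.

Lemma hall_norm_bracket_le2 (a b : Br X) :
  (forall x y z : X, (x < y)%O -> (y < z)%O -> False) ->
  B a -> B b -> hall_lt a b ->
  hall_norm iota B (lie (ev iota a) (ev iota b)) <= 2 ^+ (leaves b - 2).
Proof.
move=> X2 Ba Bb ab; apply: hall_norm_combination (_ : combination _ (bracket_support a b) _ _).
  by move=> c [].
apply: (@bracket_combination _ _ _ _ _ (fun b => 2 ^+ (leaves b - 2))) => //.
  by move=> t; rewrite exprn_ege1 // ler1n.
move=> {Ba ab} a' b' b'' Ba Bb' ab; rewrite -exprD -exprS.
apply: ler_weXn2l; rewrite ?ler1n //.
(* A letter [b'] would give three ordered letters. Otherwise [|b'| >= 2] and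
   [1 + (|b'| - 2) + (|b''| - 2) <= |b| - 2], also for [|b''| = 1], where truncated subtraction
   gives 0. *)
case: b' Bb' ab => [x|t1 t2] Bb' ab.
  by have [y [z [yx xz]]] := lyndon_node_left_letter Ba Bb' ab; case: (X2 y x z).
have := leaves_gt0 t1; have := leaves_gt0 t2; have := leaves_gt0 b''.
by rewrite /leaves /= !size_cat; lia.
Qed.

End Estimate.

Lemma card_eq2_no_chain (d : Order.disp_t) (X : orderType d) (x y z : X) :
  [set: X] #= `I_2 -> (x < y)%O -> (y < z)%O -> False.
Proof.
move=> X2 xy yz; have /card_set_bijP[f [fI finj _]] := X2.
have f2 t : (f t < 2)%N by exact: fI.
have fneq s t : (s < t)%O -> f s <> f t.
  by move=> st /finj E; move: st; rewrite E ?ltxx ?inE.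
have := fneq _ _ xy; have := fneq _ _ yz; have := fneq _ _ (lt_trans xy yz).
have := f2 x; have := f2 y; have := f2 z; lia.
Qed.

Theorem proposition7p6 (R : realType) (K : numFieldType)
    (hK : K = (R : numFieldType) \/ K = (complex R : numFieldType))
    (d : Order.disp_t) (X : orderType d) (hX : `I_2 #<= [set: X])
    (L : lieAlgType K) (iota : X -> L) (hL : free_lie iota) :
  let B := @lyndon_basis d X in
  let normB := hall_norm iota B in
  [/\ `I_3 #<= [set: X] ->
      forall a b : Br X, B a -> B b -> hall_lt a b ->
        normB (lie (ev iota a) (ev iota b)) <= 2 ^+ (leaves b - 1),
      forall X0 X1 X2 : X, (X0 < X1)%O -> (X1 < X2)%O ->
      forall n : nat,
        let b := iter n (ad (Leaf X1)) (Leaf X2) in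
        B b /\ normB (lie (ev iota (Leaf X0)) (ev iota b)) = 2 ^+ n,
      [set: X] #= `I_2 ->
      forall a b : Br X, B a -> B b -> hall_lt a b -> (2 <= leaves b)%N ->
        normB (lie (ev iota a) (ev iota b)) <= 2 ^+ (leaves b - 2) &
      forall X0 X1 : X, [set: X] = [set X0; X1] -> (X0 < X1)%O ->
      forall n : nat, (1 <= n)%N ->
        let a := iter 2 (ad (Leaf X0)) (Leaf X1) in
        let b := iter n (ad_under (Leaf X1)) (Leaf X0) in
        [/\ B a, B b, hall_lt a b &
            normB (lie (ev iota a) (ev iota b)) = 2 ^+ (n - 1)]].
Proof.
move=> B normB; split=> [_ a b|X0 X1 X2 x01 x12 n b|X2 a b Ba Bb ab _|X0 X1 _ x01 n n1 a b].
- exact: hall_norm_bracket_le.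
(* The last two conditions make [(X1, b)] a Lyndon bracket at the next induction step. *)
- have [Bb Xb left_b] : [/\ B b, hall_lt (Leaf X1) b & left_le b [:: X1]].
    rewrite /b; elim: n {b} => [|n [IH1 IH2 IH3]].
      split=> //; first exact: lyndon_basis_leaf.
      by rewrite /hall_lt lexlt_cons x12.
    split; [|rewrite /hall_lt lexlt_cons ltxx eqxx lexlt0l|exact: lexx].
      by apply: lyndon_basis_node => //; exact: lyndon_basis_leaf.
    by apply/eqP/lyndon_neq0/lyndon_foliage; exact: IH1.
  split=> //; rewrite /normB /b ev_iter_ad -[iter n _ _]scale1r.
  apply: (hall_norm_lie_iter_ad hL (z := Leaf X2)); rewrite ?normr1 //=.
  + by case=> E; rewrite E ltxx in x12.
  + exact: lyndon_basis_leaf.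
  + exact: lyndon_basis_leaf.
  + by rewrite x01.
  + by rewrite (lt_trans x01 x12).
- apply: hall_norm_bracket_le2 => // x y z; exact: card_eq2_no_chain.
- have B01 : B (Node (Leaf X0) (Leaf X1)).
    apply: lyndon_basis_node => //; try exact: lyndon_basis_leaf.
    by rewrite /hall_lt lexlt_cons x01.
  have Ba : B a.
    apply: lyndon_basis_node => //=; first exact: lyndon_basis_leaf.
    by rewrite /hall_lt lexlt_cons ltxx eqxx lexlt0l.
  (* The innermost bracket [(X0, X1)] serves as [z] in the sharpness lemma, leaving one iteration
     less: hence the exponent [n - 1]. *)
  case: n n1 @b => // n _ b; rewrite subSS subn0.
  have bE : b = iter n (ad_under (Leaf X1)) (Node (Leaf X0) (Leaf X1)).
    by rewrite /b iterSr.
  split=> //.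
  + by apply: iter_ad_under_lyndon; [exact: lyndon_basis_leaf|rewrite /= x01].
  + rewrite /hall_lt bE foliage_iter_ad_under; apply: slt_lexlt => /=.
    by rewrite ltxx eqxx x01.
  (* Turning right brackets by [X1] into left ones produces the sign [k = (-1) ^+ n]. *)
  + rewrite /normB bE ev_iter_ad_under iter_lie_right.
    apply: (hall_norm_lie_iter_ad hL (z := Node (Leaf X0) (Leaf X1))) => //=.
    * by rewrite normrX normrN1 expr1n.
    * by rewrite x01.
    * by rewrite ltxx eqxx x01.
    * by apply: prefix_lexle; rewrite prefix_cons eqxx prefix0s.
Qed.
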